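(* Let $B>0$ and let $Q$ be the quantizer $SimQ$ with parameter $B$ (defined in the context). Then, for every random vector $Y\in\mathbb{R}^d$ such that $\|Y\|_1\le B$ almost surely, $Q(Y)$ can be represented in $\log(2d+1)$ bits, $\mathbb{E}[Q(Y)\mid Y]=Y$, and $\alpha_0(Q;\infty)\le B$.
   Context: $\log$ is base 2; $e_1,\dots,e_d$ is the standard basis of $\mathbb{R}^d$; $Y(i)$ is the $i$th coordinate of $Y$; $[d]=\{1,\dots,d\}$. ''Can be represented in $b$ bits'' means that the encoder output takes values in a set of cardinality at most $2^b$. $SimQ$ with parameter $B$: given $Y\in\mathbb{R}^d$ with $\|Y\|_1\le B$, the encoder draws a random index $i^*\in\{0,1,\dots,d\}$ with $P(i^*=i\mid Y)=|Y(i)|/B$ for $i\in[d]$ and $P(i^*=0\mid Y)=1-\|Y\|_1/B$. It sets $j^*=\mathrm{sign}(Y(i^* ))$ if $i^*\in[d]$ and $j^*=1$ otherwise, and outputs $i'=i^*\cdot j^*\in\{-d,\dots,0,\dots,d\}$. The decoder, on input $i'$, outputs $B\,\mathrm{sign}(i')\,e_{|i'|}$ if $i'\ne0$ and the zero vector if $i'=0$. $Q(Y)$ is the decoder output. For a quantizer $Q$, $\alpha_0(Q;\infty)=\sup\sqrt{\mathbb{E}[\|Q(Y)\|_2^2]}$, where the supremum is over all random vectors $Y\in\mathbb{R}^d$ with $\|Y\|_1^2\le B^2$ almost surely (the Hölder conjugate of $p=\infty$ is $q=1$). *)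

(* Defs.v *)
From HB Require Import structures.
From mathcomp Require Import all_boot all_order all_algebra finmap.
From mathcomp Require Import all_classical all_reals all_analysis.

Set Implicit Arguments.
Unset Strict Implicit.
Unset Printing Implicit Defensive.

Import Order.TTheory GRing.Theory Num.Theory.

Local Open Scope classical_set_scope.
Local Open Scope ring_scope.

(* Vectors of R^d are d-tuples, which carry the product (Borel) sigma-algebra. *)
Section norms.
Context {R : realType} {d : nat}.
Implicit Types y : d.-tuple R.

Definition l1norm y : R := \sum_(k < d) `|tnth y k|.

Definition l2norm y : R := Num.sqrt (\sum_(k < d) tnth y k ^+ 2).

End norms.

Section conditional_expectation.
Context {disp disp' : measure_display} {T : measurableType disp}
  {U : measurableType disp'} {R : realType}.
Variables (P : probability T R) (Y : T -> U).

(* Z is a version of E[X | Y]. *)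
Definition is_cond_exp (X Z : T -> R) : Prop :=
  [/\ P.-integrable setT (EFin \o X),
      P.-integrable setT (EFin \o Z),
      forall D : set R, measurable D -> g_sigma_algebra_preimage Y (Z @^-1` D) &
      forall A : set T, g_sigma_algebra_preimage Y A ->
        (\int[P]_(w in A) (X w)%:E = \int[P]_(w in A) (Z w)%:E)%E].

(* Z is a version of P(E | Y). *)
Definition is_cond_prob (E : set T) (Z : T -> R) : Prop :=
  is_cond_exp (\1_E : T -> R) Z.

Definition is_cond_exp_vec {d : nat} (X Z : T -> d.-tuple R) : Prop :=
  forall k : 'I_d,
    is_cond_exp (fun w => tnth (X w) k) (fun w => tnth (Z w) k).

End conditional_expectation.

(* A randomized quantizer on R^d: on input y the encoder draws a seed i with
   probability [seed_law y i] and sends the message [encoder y i].  The numbers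
   [seed_law y i] need only be probabilities for the inputs y that the quantizer
   is meant for. *)
Record quantizer (R : realType) (d : nat) := Quantizer {
  seed : finType;
  seed_law : d.-tuple R -> seed -> R;
  message : choiceType;
  encoder : d.-tuple R -> seed -> message;
  decoder : message -> d.-tuple R
}.

Section quantization.
Context {R : realType} {d : nat}.
Variable Q : quantizer R d.

Section random_input.
Context {disp : measure_display} {T : measurableType disp}.
Variables (P : probability T R) (Y : T -> d.-tuple R) (i : T -> seed Q).

(* i is a random seed with the conditional law given Y prescribed by Q. *)
Definition draws : Prop :=
  forall j : seed Q,
    measurable (i @^-1` [set j]) /\
    is_cond_prob P Y (i @^-1` [set j]) (fun w => seed_law (Y w) j).

(* Q(Y), when the seed drawn by the encoder is i. *)
Definition quantized (w : T) : d.-tuple R :=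
  decoder (encoder (Y w) (i w)).

End random_input.

Definition representable_in_bits (b : R) : Prop :=
  exists S : {fset message Q},
    (#|` S|%:R <= 2 `^ b :> R) /\
    forall (y : d.-tuple R) (j : seed Q), encoder y j \in S.

(* alpha_0(Q; oo), as an extended real: the supremum ranges over all
   probability spaces, random vectors Y with ||Y||_1^2 <= B^2 almost surely,
   and draws of the seed of Q on input Y. *)
Definition alpha0_infty (B : R) : \bar R :=
  ereal_sup [set x : \bar R |
    exists (disp : measure_display) (T : measurableType disp)
           (P : probability T R) (Y : {RV P >-> d.-tuple R}) (i : T -> seed Q),
      [/\ {ae P, forall w, l1norm (Y w) ^+ 2 <= B ^+ 2},
          draws P Y i &
          x = sqrte 'E_P[fun w => l2norm (quantized Y i w) ^+ 2]]].

End quantization.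

Definition log2 {R : realType} (x : R) : R := ln x / ln 2.

Section simq.
Context {R : realType} (d : nat) (B : R).
Implicit Types y : d.-tuple R.

(* Coordinates are indexed from 0 in 'I_d: the index lift ord0 k, of value k.+1,
   stands for the coordinate tnth y k. *)
Definition simq_law y (i : 'I_d.+1) : R :=
  if unlift ord0 i is Some k then `|tnth y k| / B else 1 - l1norm y / B.

Definition simq_encoder y (i : 'I_d.+1) : int :=
  Posz i * (if unlift ord0 i is Some k then sgz (tnth y k) else 1).

Definition basis_vec (n : nat) : d.-tuple R :=
  [tuple (k.+1 == n)%:R | k < d].

Definition simq_decoder (m : int) : d.-tuple R :=
  if m == 0 then [tuple 0 | k < d]
  else [tuple B * (sgz m)%:~R * tnth (basis_vec `|m|%N) k | k < d].

Definition simq : quantizer R d :=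
  @Quantizer R d 'I_d.+1 simq_law int simq_encoder simq_decoder.

End simq.

(* Main.v *)
(* The k-th coordinate of the decoder output is B sign(Y(k)) 1[i* = k].  The
   event i* = k has conditional probability |Y(k)|/B given Y, and sign(Y(k)) is
   a function of Y, so the conditional expectation is
   B sign(Y(k)) |Y(k)|/B = Y(k).  At most one coordinate of the output is
   nonzero, with absolute value at most B, which bounds the second moment by
   B^2. *)
Require Import Defs.
From mathcomp Require Import all_boot all_order all_algebra finmap.
From mathcomp Require Import all_classical all_reals all_analysis.
From mathcomp Require Import measurable_realfun zify.

Import Order.TTheory GRing.Theory Num.Theory.
Local Open Scope classical_set_scope.
Local Open Scope ring_scope.

Lemma absz_sgz (R : realDomainType) (x : R) : `|sgz x|%N = (x != 0).
Proof. by case: sgzP. Qed.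

Lemma sgr_indic (R : realType) (x : R) :
  Num.sg x = \1_`]0, +oo[%classic x - \1_`]-oo, 0[%classic x.
Proof.
by rewrite !indicE !mem_setE !in_itv/= andbT; case: sgrP => _;
  rewrite ?subrr ?subr0 ?sub0r.
Qed.

Lemma measurable_sgr (R : realType) : measurable_fun [set: R] (@Num.sg R).
Proof.
rewrite (_ : Num.sg = \1_`]0, +oo[%classic \- \1_`]-oo, 0[%classic).
  by apply: measurable_funB; apply: measurable_indic; exact: measurable_itv.
by apply/funext => x; exact: sgr_indic.
Qed.

Section sign_multiplier.
Context {disp : measure_display} {T : measurableType disp} {R : realType}.
Context {mu : {measure set T -> \bar R}} {h f : T -> R}.
Hypotheses (mh : measurable_fun [set: T] h)
  (intf : mu.-integrable [set: T] (EFin \o f)).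

(** The sign has absolute value at most 1, so [f] dominates the product. *)
Lemma integrable_sgrM :
  mu.-integrable [set: T] (EFin \o (fun w => Num.sg (h w) * f w)).
Proof.
apply: (le_integrable measurableT _ _ intf).
  apply/measurable_EFinP; apply: measurable_funM.
    exact: measurableT_comp (@measurable_sgr R) mh.
  by apply/measurable_EFinP; case/integrableP: intf.
move=> w _ /=; rewrite lee_fin normrM normr_sg.
by case: eqP => _; rewrite ?mul0r ?mul1r.
Qed.

(** Trades the multiplier for a restriction of the domain: only integrals of [f] itself over sets
    remain, the form in which a conditional expectation is specified. *)
Lemma integral_sgrM {A : set T} : measurable A ->
  (\int[mu]_(w in A) (Num.sg (h w) * f w)%:E =
   \int[mu]_(w in A `&` h @^-1` `]0%R, +oo[) (f w)%:E -
   \int[mu]_(w in A `&` h @^-1` `]-oo, 0%R[) (f w)%:E)%E.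
Proof.
move=> mA.
have mS (J : interval R) : measurable (h @^-1` [set` J]).
  by rewrite -[X in measurable X]setTI; apply: mh => //; exact: measurable_itv.
have iS (J : interval R) :
    mu.-integrable A ((EFin \o f) \_ (h @^-1` [set` J])).
  apply/integrable_restrict => //; apply: integrableS intf => //.
  exact: measurableI.
(* All three integrals now run over [A], so a pointwise check by the sign of [h w] suffices. *)
rewrite !integral_mkcondr -integralB//; apply: eq_integral => w _.
have inS (J : interval R) : (w \in h @^-1` [set` J]) = (h w \in J).
  by apply/idP/idP; rewrite inE.
rewrite !patchE !inS !in_itv/= andbT.
by case: sgrP => _;
  rewrite ?mul0r ?mul1r ?mulN1r ?sube0 ?sub0e.
Qed.

End sign_multiplier.

Section conditional_expectation.
Context {disp disp' : measure_display} {T : measurableType disp}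
  {U : measurableType disp'} {R : realType}.
Context {P : probability T R} {Y : T -> U}.
Hypothesis mY : measurable_fun [set: T] Y.

Lemma sub_g_sigma_algebra_preimage {A : set T} :
  g_sigma_algebra_preimage Y A -> measurable A.
Proof. by case=> C mC <-; exact: mY. Qed.

(* Taking out what is known, for the multiplier sign(g(Y)). *)
Lemma is_cond_exp_sgrM {g : U -> R} {X Z : T -> R} {A : set T} :
  measurable_fun [set: U] g -> is_cond_exp P Y X Z ->
  g_sigma_algebra_preimage Y A ->
  (\int[P]_(w in A) (Num.sg (g (Y w)) * X w)%:E =
   \int[P]_(w in A) (Num.sg (g (Y w)) * Z w)%:E)%E.
Proof.
move=> mg [intX intZ _ XZ] YA.
have mgY : measurable_fun [set: T] (g \o Y) by exact: measurableT_comp.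
have mA := sub_g_sigma_algebra_preimage YA.
rewrite (integral_sgrM mgY intX mA) (integral_sgrM mgY intZ mA).
(* Cutting [A] by the sign of [g (Y w)] gives another preimage under [Y], so the defining identity
   of the conditional expectation applies to each piece. *)
have YAS (J : interval R) :
    g_sigma_algebra_preimage Y (A `&` (g \o Y) @^-1` [set` J]).
  case: YA => C mC <-; exists (C `&` g @^-1` [set` J]); last first.
    by rewrite !setTI preimage_setI comp_preimage.
  apply: measurableI => //; rewrite -[X in measurable X]setTI.
  by apply: mg => //; exact: measurable_itv.
by rewrite !XZ.
Qed.

End conditional_expectation.

Section simq.
Context {R : realType} {d : nat} (B : R).

(** Separates the two sources of randomness: a function of [y] times an indicator of the seed. *)
Lemma tnth_simq (y : d.-tuple R) (j : 'I_d.+1) (k : 'I_d) :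
  tnth (simq_decoder d B (simq_encoder y j)) k =
  B * (Num.sg (tnth y k) * (j == lift ord0 k)%:R).
Proof.
rewrite /simq_decoder /simq_encoder.
case: (unliftP ord0 j) => [l ->|->]; last first.
  by rewrite mul0r eqxx tnth_mktuple (negbTE (neq_lift _ _)) !mulr0.
rewrite (inj_eq lift_inj) mulf_eq0 sgz_eq0 /=.
(* If the drawn coordinate of [y] is zero, the message is 0 and decodes to the zero vector; this
   agrees with the right side because the sign of 0 is 0. *)
case: ifPn => [yl0|yl0]; rewrite tnth_mktuple.
  have [lk|_] := eqVneq l k; last by rewrite !mulr0.
  by rewrite -lk (eqP yl0) sgr0 mul0r mulr0.
rewrite sgzM sgz_id /= mul1r -sgrEz tnth_mktuple abszM absz_sgz yl0 muln1.
rewrite /= /bump /= add1n eqSS eq_sym.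
have [->|lk] := eqVneq l k; first by rewrite eqxx mulrA.
by rewrite -[(_ == _ :> nat)]/(l == k) (negbTE lk) !mulr0.
Qed.

Lemma l2norm_simq_le (y : d.-tuple R) (j : 'I_d.+1) :
  l2norm (simq_decoder d B (simq_encoder y j)) ^+ 2 <= B ^+ 2.
Proof.
rewrite sqr_sqrtr; last by apply: sumr_ge0 => k _; exact: sqr_ge0.
under eq_bigr do rewrite tnth_simq.
case: (unliftP ord0 j) => [l ->|->]; last first.
  rewrite big1 ?sqr_ge0// => k _.
  by rewrite (negbTE (neq_lift _ _)) !mulr0 expr0n.
rewrite (bigD1 l)//= big1 => [|k /negbTE kl]; last first.
  by rewrite (inj_eq lift_inj) eq_sym kl !mulr0 expr0n.
rewrite eqxx mulr1 addr0 exprMn sqr_sg.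
by case: eqP => _; rewrite ?mulr0 ?mulr1 ?sqr_ge0.
Qed.

Lemma simq_representable :
  representable_in_bits (simq d B) (log2 (2 * d + 1)%:R).
Proof.
(* The integers from [-d] to [d], as 0 to [2 * d] shifted by [d]. *)
exists [fset m in [seq (Posz n - Posz d)%R | n <- iota 0 (2 * d + 1)]]%fset.
split.
  rewrite card_fseq /powR pnatr_eq0 /= /log2 divfK; last first.
    by rewrite gt_eqF// ln_gt0// ltr1n.
  rewrite lnK ?posrE ?ltr0n ?addn1// ler_nat.
  by rewrite (leq_trans (size_undup _))// size_map size_iota.
move=> y j; rewrite inE.
have : (`|simq_encoder y j| <= d)%N.
  rewrite /simq_encoder abszM -[leqRHS]muln1 leq_mul ?leq_ord//.
  by case: unliftP => [k _|_ //]; rewrite absz_sgz leq_b1.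
rewrite /=; move: (simq_encoder y j) => m md.
(* Since [m] is at least [-d], the absolute value only converts [m + d] to a natural number. *)
apply/mapP; exists `|(m + Posz d)%R|%N; last by lia.
by rewrite mem_iota; lia.
Qed.

Section random_input.
Context {disp : measure_display} {T : measurableType disp}.
Context {P : probability T R} {Y : {RV P >-> d.-tuple R}}
  {i : T -> seed (simq d B)}.
Hypothesis iY : draws P Y i.

(** The seed enters only through the indicator whose conditional expectation [draws] prescribes. *)
Let X (k : 'I_d) : T -> R :=
  fun w => B * (Num.sg (tnth (Y w) k) * \1_(i @^-1` [set lift ord0 k]) w).

Let quantizedE (w : T) (k : 'I_d) : tnth (quantized Y i w) k = X k w.
Proof.
rewrite [LHS]tnth_simq /X indicE; congr (_ * (_ * _%:R)).
by congr nat_of_bool; apply/eqP/idP => [iw|]; rewrite inE.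
Qed.

Let mYk (k : 'I_d) : measurable_fun [set: T] (fun w => tnth (Y w) k).
Proof. by apply: measurableT_comp (measurable_tnth k) _. Qed.

Let mX (k : 'I_d) : measurable_fun [set: T] (X k).
Proof.
apply: measurable_funM => //; apply: measurable_funM.
  exact: measurableT_comp (@measurable_sgr R) (mYk k).
by apply: measurable_indic; case: (iY (lift ord0 k)).
Qed.

Lemma simq_unbiased : B != 0 -> is_cond_exp_vec P Y (quantized Y i) Y.
Proof.
move=> B0 k.
have [mE] := iY (lift ord0 k).
rewrite /simq/= => EZ.
set Z := fun w => _ in EZ.
(* Here [Z] is the absolute value of the coordinate divided by [B], and a real is its sign times its
   absolute value. *)
have ZE w : tnth (Y w) k = B * (Num.sg (tnth (Y w) k) * Z w).
  by rewrite /Z /simq_law liftK (mulrA (Num.sg _)) mulr_sg_norm mulrC divfK.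
have -> : (fun w => tnth (quantized Y i w) k) = X k.
  by apply/funext => w; exact: quantizedE.
have [intE intZ _ _] := EZ.
have intBsg f : P.-integrable [set: T] (EFin \o f) ->
    P.-integrable [set: T]
      (EFin \o (fun w => B * (Num.sg (tnth (Y w) k) * f w))).
  move=> intf.
  exact: (integrableZl measurableT B (integrable_sgrM (mYk k) intf)).
split.
- exact: intBsg.
(* Integrability of the coordinate of [Y] is inherited from [Z], a version of a conditional
   probability. *)
- by rewrite (_ : (fun _ => _) = fun w => B * (Num.sg (tnth (Y w) k) * Z w));
    [exact: intBsg | exact/funext].
- move=> D mD; exists ((fun y : d.-tuple R => tnth y k) @^-1` D).
    by rewrite -[X in measurable X]setTI; exact: measurable_tnth.
  by rewrite setTI.
- move=> A YA.
  have mA := sub_g_sigma_algebra_preimage (measurable_funPT Y) YA.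
  under [RHS]eq_integral do rewrite ZE.
  have intBE f : P.-integrable [set: T] (EFin \o f) ->
      (\int[P]_(w in A) (B * (Num.sg (tnth (Y w) k) * f w))%:E =
       B%:E * \int[P]_(w in A) (Num.sg (tnth (Y w) k) * f w)%:E)%E.
    move=> intf; rewrite -integralZl//.
    exact: integrableS (integrable_sgrM (mYk k) intf).
  rewrite (intBE _ intE) (intBE _ intZ); congr (_ * _)%E.
  exact: (is_cond_exp_sgrM (measurable_funPT Y) (measurable_tnth k) EZ YA).
Qed.

Lemma simq_second_moment :
  ('E_P[fun w => (l2norm (quantized Y i w) ^+ 2)%R] <= (B ^+ 2)%:E)%E.
Proof.
rewrite -(expectation_cst P); apply: expectation_le => //.
(* Measurability of the squared norm comes from the formula [X] for the coordinates, each of which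
   is measurable. *)
- rewrite (_ : (fun _ => _) = fun w => \sum_(k < d) X k w ^+ 2).
    by apply: measurable_sum => k; exact: measurable_funX.
  apply/funext => w; rewrite sqr_sqrtr; last first.
    by apply: sumr_ge0 => k _; exact: sqr_ge0.
  by apply: eq_bigr => k _; rewrite quantizedE.
- by move=> w; exact: sqr_ge0.
- by move=> w; exact: sqr_ge0.
- by apply: aeW => w; exact: l2norm_simq_le.
Qed.

End random_input.

Lemma alpha0_simq_le : 0 <= B -> (alpha0_infty (simq d B) B <= B%:E)%E.
Proof.
move=> B0; apply: ge_ereal_sup => _ [disp [T [P [Y [i [_ iY ->]]]]]].
have -> : B%:E = sqrte (B ^+ 2)%:E by rewrite /= sqrtr_sqr ger0_norm.
by rewrite lee_sqrt ?lee_fin ?sqr_ge0//; exact: simq_second_moment.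
Qed.

End simq.

Theorem theorem4p1 (R : realType) (d : nat) (B : R) (hB : 0 < B) :
  [/\ representable_in_bits (simq d B) (log2 (2 * d + 1)%:R),
      forall (disp : measure_display) (T : measurableType disp)
        (P : probability T R) (Y : {RV P >-> d.-tuple R})
        (i : T -> seed (simq d B)),
        {ae P, forall w, l1norm (Y w) <= B} ->
        draws P Y i ->
        is_cond_exp_vec P Y (quantized Y i) Y &
      (alpha0_infty (simq d B) B <= B%:E)%E].
Proof.
split.
- exact: simq_representable.
- by move=> disp T P Y i _ iY; apply: simq_unbiased => //; rewrite gt_eqF.
- exact/alpha0_simq_le/ltW.
Qed.
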